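(* Every signature of the Petersen graph $P$ is switching isomorphic to exactly one of the six signed graphs $+P$, $P_1$, $P_{2,2}$, $P_{2,3}$, $P_{3,2}$, $P_{3,3}$; that is, there are exactly six switching isomorphism classes of signed Petersen graphs. Moreover, $+P \simeq -P_{3,3}$, $P_1 \simeq -P_{2,3}$, $P_{2,2} \simeq -P_{2,2}$, $P_{2,3} \simeq -P_1$, $P_{3,2} \simeq -P_{3,2}$, and $P_{3,3} \simeq -P$.
   Context: The Petersen graph $P$ has the ten vertices $v_{ij}$ indexed by the 2-element subsets $\{i,j\}$ of $\{1,2,3,4,5\}$, with $v_{ij}$ adjacent to $v_{kl}$ if and only if $\{i,j\}\cap\{k,l\}=\emptyset$. A signature is a map $\sigma:E(P)\to\{+,-\}$ and $(P,\sigma)$ is a signed Petersen graph; $-(P,\sigma)=(P,-\sigma)$ is its negation. For a switching function $\zeta:V\to\{+,-\}$, the switched signature is $\sigma^\zeta(vw)=\zeta(v)\sigma(vw)\zeta(w)$. Two signed graphs on the same underlying graph are switching equivalent if one is a switching of the other; signed graphs are isomorphic if there is a graph isomorphism preserving edge signs; they are switching isomorphic ($\simeq$) if one is isomorphic to a switching of the other. The distance between two edges is their distance in the line graph (adjacent edges have distance 1); in $P$ two disjoint edges have distance 2 if some edge joins an endpoint of one to an endpoint of the other, and distance 3 otherwise. A hexagon is a 6-cycle of $P$. Named signatures (each well defined up to isomorphism): $+P$ has all edges positive, $-P$ all edges negative; $P_1$ has exactly one negative edge; $P_{2,2}$ (resp. $P_{2,3}$) has exactly two negative edges, at distance 2 (resp.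 3); $P_{3,2}$ has exactly three negative edges, which are alternate edges of some hexagon; $P_{3,3}$ has exactly three negative edges, pairwise at distance 3. *)

(* Defs.v *)
From mathcomp Require Import all_boot perm.

Set Implicit Arguments.
Unset Strict Implicit.
Unset Printing Implicit Defensive.

Section SignedGraphs.

(* A graph is given by its adjacency relation, meant to be symmetric and
   irreflexive; [padj_sym] and [padj_irr] check this for the Petersen graph. *)
Variables (V : finType) (adj : rel V).

Definition is_edge (e : {set V}) : bool :=
  [exists u, exists v, adj u v && (e == [set u; v])].

Definition edge : Type := {e : {set V} | is_edge e}.

(* Signs are booleans: [true] is the sign -, [false] is the sign +, so that
   [addb] is the product of signs. *)
Definition signature : Type := {ffun edge -> bool}.

Implicit Types (s t : signature) (e f : edge) (z : {ffun V -> bool}).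

Definition all_pos : signature := [ffun => false].

Definition negate s : signature := [ffun e => ~~ s e].

Definition neg_edges s : {set edge} := [set e | s e].

(* The product of the sign of e and of the signs z v of its two ends;
   see [switchE]. *)
Definition switch z s : signature :=
  [ffun e => s e (+) \big[addb/false]_(v in val e) z v].

Definition isomorphic s t : bool :=
  [exists p : {perm V},
     [forall u, forall v, adj (p u) (p v) == adj u v] &&
     [forall e : edge, forall f : edge, (val f == p @: val e) ==> (t f == s e)]].

Definition switching_isomorphic s t : bool :=
  [exists z : {ffun V -> bool}, isomorphic s (switch z t)].

Definition line_adj : rel edge :=
  fun e f => (e != f) && ~~ [disjoint val e & val f].

Definition edge_dist e f (d : nat) : Prop :=
  (exists2 p : seq edge, path line_adj e p & last e p = f /\ size p = d) /\
  (forall p : seq edge, path line_adj e p -> last e p = f -> d <= size p).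

Definition neg_at_dist s (k d : nat) : Prop :=
  #|neg_edges s| = k /\
  {in neg_edges s &, forall e f, e != f -> edge_dist e f d}.

Definition neg_alternate_hexagon s : Prop :=
  exists a b c d e f : V,
    ucycle adj [:: a; b; c; d; e; f] /\
    [set val x | x : edge in neg_edges s] = [set [set a; b]; [set c; d]; [set e; f]].

Lemma switchE z s e u v : u != v -> val e = [set u; v] ->
  switch z s e = z u (+) s e (+) z v.
Proof.
move=> uv eE; rewrite ffunE eE big_setU1 ?inE //= big_set1.
by rewrite addbA [s e (+) _]addbC.
Qed.

End SignedGraphs.

Notation "s ~=sw t" := (switching_isomorphic s t) (at level 70).

Definition petersen : Type := {A : {set 'I_5} | #|A| == 2}.

Definition padj : rel petersen := fun u v => [disjoint val u & val v].

Lemma padj_sym : symmetric padj.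
Proof. by move=> u v; rewrite /padj disjoint_sym. Qed.

Lemma padj_irr : irreflexive padj.
Proof.
move=> u; apply/negP; rewrite /padj -setI_eq0 setIid => /eqP u0.
by have := valP u; rewrite u0 cards0.
Qed.

Notation psignature := (signature padj).

Definition plusP : psignature := all_pos padj.

Definition is_P1 (s : psignature) : Prop := #|neg_edges s| = 1.
Definition is_P22 (s : psignature) : Prop := neg_at_dist s 2 2.
Definition is_P23 (s : psignature) : Prop := neg_at_dist s 2 3.
Definition is_P32 (s : psignature) : Prop := neg_alternate_hexagon s.
Definition is_P33 (s : psignature) : Prop := neg_at_dist s 3 3.

(* Main.v *)
(* A switching class of signatures is determined by the signs off a spanning
   tree, so there are 2^6 = 64 of them.  For each of these 64 normal forms an
   automorphism of the Petersen graph, taken among the 120 induced by the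
   permutations of the five symbols, carries it to one of the six named
   signatures; this is a finite computation.  In the other direction, the
   numbers of negative closed walks of length 5 and 6 are invariant under
   switching isomorphism, and these pairs of numbers are distinct for the six
   signatures. *)
Require Import Defs.
From mathcomp Require Import all_boot perm.

Set Implicit Arguments.
Unset Strict Implicit.
Unset Printing Implicit Defensive.

(** * Auxiliary facts on finite sets, bounded checks and partitions *)

Lemma set2_eq (T : finType) (x y a b : T) : x != y ->
  ([set x; y] == [set a; b]) = ((x == a) && (y == b)) || ((x == b) && (y == a)).
Proof.
move=> xy; apply/eqP/orP => [xyab | [/andP[/eqP-> /eqP->] // | ]].
  have /set2P xab : x \in [set a; b] by rewrite -xyab set21.
  have /set2P yab : y \in [set a; b] by rewrite -xyab set22.
  case: xab yab xy => -> [] ->; rewrite !eqxx //=; first by left.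
  by right.
by move=> /andP[/eqP-> /eqP->]; rewrite setUC.
Qed.

Lemma all_lt n (P : pred nat) : all P (iota 0 n) -> forall i, i < n -> P i.
Proof. by move=> /allP PP i i_lt; apply: PP; rewrite mem_iota. Qed.

Lemma all2_lt n (r : rel nat) :
  all (fun i => all (r i) (iota 0 n)) (iota 0 n) ->
  forall i j, i < n -> j < n -> r i j.
Proof. by move=> /all_lt rr i j /rr/all_lt; apply. Qed.

Lemma inord_eq n i j : i < n.+1 -> j < n.+1 ->
  (inord i == inord j :> 'I_n.+1) = (i == j).
Proof. by move=> i_lt j_lt; rewrite -val_eqE /= !inordK. Qed.

(** For [x] and [y] the signs of corresponding edges and the other letters switching values at their
    ends: if the switched signs agree, the product of the two switchings carries [x] to [y]. *)
Lemma addb_exchange a b c d x y :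
  a (+) x (+) b = c (+) y (+) d -> y = (a (+) c) (+) x (+) (b (+) d).
Proof. by move: a b c d x y => [] [] [] [] [] []. Qed.

Lemma set_seq_card (T : finType) (A : {set T}) (s : seq T) :
  uniq s -> {subset s <= A} -> #|A| = size s -> A = [set x in s].
Proof.
move=> s_uniq sA As; apply/esym/eqP.
rewrite eqEcard As cardsE (card_uniqP s_uniq) leqnn andbT.
by apply/subsetP=> x; rewrite inE => /sA.
Qed.

(** The classes of the representatives [x k] exhaust the partition and are pairwise distinct, so the
    blocks correspond bijectively to the indices below [n]. *)
Lemma card_equivalence_partition (T : finType) (R : rel T) n (x : nat -> T) :
  (forall s, R s s) -> (forall s t, R s t -> R t s) ->
  (forall s t r, R s t -> R t r -> R s r) ->
  (forall s, exists2 k, k < n & R s (x k)) ->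
  (forall k l, k < n -> l < n -> R (x k) (x l) -> k = l) ->
  #|equivalence_partition R setT| = n.
Proof.
move=> R_refl R_sym R_trans R_rep x_inj.
rewrite (_ : equivalence_partition _ _ = [set [set t | R (x k) t] | k : 'I_n]).
  rewrite card_imset ?card_ord // => k l /setP/(_ (x l)).
  by rewrite !inE R_refl => kl; apply/val_inj/(x_inj _ _ (ltn_ord k) (ltn_ord l) kl).
apply/setP=> X; apply/imsetP/imsetP => [[s _ ->] | [k _ ->]].
  have [k k_lt sk] := R_rep s; exists (Ordinal k_lt) => //.
  apply/setP=> t; rewrite !inE; apply/idP/idP.
    exact: (R_trans _ _ _ (R_sym _ _ sk)).
  exact: (R_trans _ _ _ sk).
by exists (x k) => //; apply/setP=> t; rewrite !inE.
Qed.

(** * Switching isomorphism of signed graphs *)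

Section GenericSignedGraphs.

Variables (V : finType) (adj : rel V).
Hypotheses (adj_sym : symmetric adj) (adj_irr : irreflexive adj).

Implicit Types (s t : signature adj) (e f : edge adj) (u v w : V).

Lemma adj_neq u v : adj u v -> u != v.
Proof. by apply: contraTneq => ->; rewrite adj_irr. Qed.

Lemma edgeP e : exists u v, adj u v /\ val e = [set u; v].
Proof.
by have /existsP[u /existsP[v /andP[uv /eqP eE]]] := valP e; exists u, v.
Qed.

Lemma adj_edge u v : adj u v -> exists e, val e = [set u; v].
Proof.
move=> uv.
have uvP : is_edge adj [set u; v].
  by apply/existsP; exists u; apply/existsP; exists v; rewrite uv eqxx.
by exists (Sub _ uvP); rewrite SubK.
Qed.

Lemma edge_set2 e u v : u != v -> u \in val e -> v \in val e ->
  val e = [set u; v] /\ adj u v.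
Proof.
have [x [y [xy ->]]] := edgeP e.
move=> uv /set2P[uE|uE] /set2P[vE|vE]; move: uv; rewrite uE vE ?eqxx // => _.
by split; [rewrite setUC | rewrite adj_sym].
Qed.

(* The sign of [uv], extended by [+] to the non-adjacent pairs. *)
Definition sgn s u v : bool :=
  if insub [set u; v] is Some e then s e else false.

Lemma sgnE s e u v : val e = [set u; v] -> sgn s u v = s e.
Proof. by rewrite /sgn => <-; rewrite valK. Qed.

Lemma sgnC s u v : sgn s u v = sgn s v u.
Proof. by rewrite /sgn setUC. Qed.

Lemma sgn_negate s u v : adj u v -> sgn (negate s) u v = ~~ sgn s u v.
Proof. by move=> /adj_edge[e eE]; rewrite !(sgnE _ eE) ffunE. Qed.

(** The switching acts on the source [s], before [p], so that no inverse of [p] appears; [swP] moves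
    it to the target by composing with [p] or its inverse. *)
Definition sw_rel s t (p : {perm V}) (z : V -> bool) : Prop :=
  (forall u v, adj (p u) (p v) = adj u v) /\
  (forall u v, adj u v -> sgn t (p u) (p v) = z u (+) sgn s u v (+) z v).

Lemma swP s t : s ~=sw t <-> exists p z, sw_rel s t p z.
Proof.
split=> [/existsP[z /existsP[p /andP[/forallP pP /forallP ptP]]]|].
  have p_adj u v : adj (p u) (p v) = adj u v by have /forallP/(_ v)/eqP := pP u.
  exists p, (z \o p); split=> // u v uv.
  have [e eE] := adj_edge uv.
  have puv : adj (p u) (p v) by rewrite p_adj.
  have [f fE] := adj_edge puv.
  have /forallP/(_ f)/implyP := ptP e.
  rewrite fE eE imsetU1 imset_set1 => /(_ (eqxx _))/eqP.
  rewrite (switchE _ _ (adj_neq puv) fE) (sgnE _ eE) (sgnE _ fE) => <- /=.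
  by case: (z _); case: (z _); case: (t f).
case=> p [z [p_adj ptP]].
apply/existsP; exists [ffun u => z ((p^-1)%g u)]; apply/existsP; exists p.
apply/andP; split.
  by apply/forallP=> u; apply/forallP=> v; rewrite p_adj.
apply/forallP=> e; apply/forallP=> f; apply/implyP=> /eqP.
have [u [v [uv eE]]] := edgeP e.
have puv : adj (p u) (p v) by rewrite p_adj.
rewrite eE imsetU1 imset_set1 => fE.
rewrite (switchE _ _ (adj_neq puv) fE) !ffunE !permK.
rewrite -(sgnE _ fE) ptP // (sgnE _ eE).
by case: (z _); case: (z _); case: (s e).
Qed.

Lemma sw_refl s : s ~=sw s.
Proof.
apply/swP; exists 1%g, (fun=> false); split=> u v; rewrite !perm1 //.
by rewrite addbF.
Qed.

Lemma sw_sym s t : s ~=sw t -> t ~=sw s.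
Proof.
move=> /swP[p [z [p_adj pst]]]; apply/swP.
exists (p^-1)%g, (fun u => z ((p^-1)%g u)); split=> u v.
  by rewrite -p_adj !permKV.
move=> uv; have uv' : adj ((p^-1)%g u) ((p^-1)%g v) by rewrite -p_adj !permKV.
have := pst _ _ uv'; rewrite !permKV => ->.
by case: (z _); case: (z _); case: (sgn s _ _).
Qed.

Lemma sw_trans s t r : s ~=sw t -> t ~=sw r -> s ~=sw r.
Proof.
move=> /swP[p [z [p_adj pst]]] /swP[q [y [q_adj qtr]]]; apply/swP.
exists (p * q)%g, (fun u => z u (+) y (p u)); split=> u v; rewrite !permM.
  by rewrite q_adj p_adj.
move=> uv; rewrite qtr ?p_adj // pst //.
by case: (z _); case: (z _); case: (y _); case: (y _); case: (sgn s _ _).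
Qed.

Lemma sw_negate s t : s ~=sw t -> negate s ~=sw negate t.
Proof.
move=> /swP[p [z [p_adj pst]]]; apply/swP; exists p, z; split=> // u v uv.
rewrite !sgn_negate ?p_adj // pst //.
by case: (z _); case: (z _); case: (sgn s _ _).
Qed.

(** * Signed closed walks as invariants *)

(** The number of walks of length [n] from [u] to [v] whose product of signs is [b]. *)
Fixpoint walks s n u v b : nat :=
  if n is n'.+1 then \sum_(w | adj u w) walks s n' w v (b (+) sgn s u w)
  else (u == v) && ~~ b.

Definition neg_closed_walks s n : nat := \sum_u walks s n u u true.

(** The switching values at inner vertices of a walk occur twice and cancel; only those at the two
    ends remain. For closed walks these cancel as well. *)
Lemma walks_sw s t p z n u v b : sw_rel s t p z ->
  walks t n (p u) (p v) b = walks s n u v (b (+) z u (+) z v).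
Proof.
case=> p_adj pst; elim: n u b => [|n IHn] u b /=.
  rewrite (inj_eq perm_inj); case: eqP => //= ->.
  by case: (z v); case: b.
rewrite (reindex_inj (@perm_inj _ p)) /=.
apply: eq_big => w; first exact: p_adj.
rewrite p_adj => uw; rewrite IHn pst //; congr walks.
by case: b; case: (z u); case: (z w); case: (z v); case: (sgn s u w).
Qed.

Lemma neg_closed_walks_sw s t n :
  s ~=sw t -> neg_closed_walks s n = neg_closed_walks t n.
Proof.
move=> /swP[p [z st]]; rewrite /neg_closed_walks.
rewrite [RHS](reindex_inj (@perm_inj _ p)); apply: eq_bigr => u _ /=.
by rewrite (walks_sw _ _ _ _ st) -addbA addbb addbF.
Qed.

(** * Distances two and three in the line graph *)

Definition joined e f : Prop := exists u v, [/\ u \in val e, v \in val f & adj u v].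

Lemma line_adjP e f :
  reflect (e != f /\ exists2 u, u \in val e & u \in val f) (line_adj e f).
Proof.
rewrite /line_adj -setI_eq0; apply: (iffP andP) => -[ef].
  by case/set0Pn=> u /setIP[ue uf]; split=> //; exists u.
by case=> u ue uf; split=> //; apply/set0Pn; exists u; rewrite inE ue.
Qed.

Lemma disjoint_edge_neq e f : [disjoint val e & val f] -> e != f.
Proof.
apply: contraTneq => ->; have [u [v [_ ->]]] := edgeP f.
by rewrite -setI_eq0 setIid; apply/set0Pn; exists u; rewrite set21.
Qed.

Lemma joinedP e f : [disjoint val e & val f] ->
  joined e f <-> exists g, line_adj e g && line_adj g f.
Proof.
move=> disj; split=> [[u [v [ue vf uv]]] | [g /andP[]]].
  have [g gE] := adj_edge uv; exists g; have efF := disjointFr disj.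
  have ug : u \in val g by rewrite gE set21.
  have vg : v \in val g by rewrite gE set22.
  apply/andP; split; apply/line_adjP; split; try by [exists u | exists v].
    by apply: contraTneq vf => eg; rewrite efF // eg.
  by apply: contraTneq ue => gf; apply: contraTN ug => /efF; rewrite gf => ->.
move=> /line_adjP[_ [u ue ug]] /line_adjP[_ [v vg vf]]; exists u, v; split=> //.
(* The middle edge [g] contains both [u] and [v], so once they are distinct they are its two
   ends. *)
suff uv : u != v by have [] := edge_set2 uv ug vg.
by apply: contraTneq vf => <-; rewrite (disjointFr disj).
Qed.

Lemma edge_dist_disjoint e f d :
  e != f -> 1 < d -> edge_dist e f d -> [disjoint val e & val f].
Proof.
move=> ef d_gt1 [_ min_d]; apply/negPn/negP => ndisj.
(* If the edges met, [[:: f]] would be a path of length 1, below [d]. *)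
have := min_d [:: f]; rewrite /= /line_adj ef ndisj => /(_ isT erefl).
by rewrite leqNgt d_gt1.
Qed.

Lemma disjoint_path_gt1 e f p : [disjoint val e & val f] ->
  path (@line_adj _ adj) e p -> last e p = f -> 1 < size p.
Proof.
move=> disj; have /negPf ef := disjoint_edge_neq disj.
case: p => [_ /= /eqP|g [|//]]; first by rewrite ef.
by rewrite /= andbT => /[swap] ->; rewrite /line_adj disj andbF.
Qed.

Lemma edge_dist2P e f : e != f ->
  edge_dist e f 2 <-> [disjoint val e & val f] /\ joined e f.
Proof.
move=> ef; split=> [ef2 | [disj /(joinedP disj)[g egf]]].
  have disj := edge_dist_disjoint ef (isT : 1 < 2) ef2; split=> //; apply/joinedP => //.
  case: ef2 => -[p path_p [last_p size_p]] _.
  case: p path_p last_p size_p => [|g [|h [|]]] //= egf fE _; exists g.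
  by move: egf; rewrite /= andbT -fE.
split=> [|p]; last exact: disjoint_path_gt1.
by exists [:: g; f]; rewrite //= andbT.
Qed.

Lemma edge_dist3_far e f : e != f -> edge_dist e f 3 ->
  [disjoint val e & val f] /\ ~ joined e f.
Proof.
move=> ef ef3; have disj := edge_dist_disjoint ef (isT : 1 < 3) ef3; split=> //.
move=> /(joinedP disj)[g egf]; case: ef3 => _ /(_ [:: g; f]).
by rewrite /= andbT => /(_ egf erefl).
Qed.

(** The edges [uw] and [wv] give a path of length 3 from [e] to [f]. Disjointness rules out lengths
    0 and 1, and a path of length 2 would join [e] and [f]. *)
Lemma far_edge_dist3 e f u v w : [disjoint val e & val f] -> ~ joined e f ->
  u \in val e -> v \in val f -> adj u w -> adj w v -> edge_dist e f 3.
Proof.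
move=> disj njoin ue vf uw wv.
have we : w \notin val e by apply/negP=> we; apply: njoin; exists w, v.
have wf : w \notin val f by apply/negP=> wf; apply: njoin; exists u, w.
have [[g gE] [h hE]] := (adj_edge uw, adj_edge wv).
split=> [|p].
  exists [:: g; h; f] => //=; rewrite andbT; apply/and3P; split; apply/line_adjP.
  - split; last by exists u; rewrite // gE set21.
    by apply: contraNneq we => ->; rewrite gE set22.
  - split; last by exists w; rewrite ?gE ?set22 // hE set21.
    (* If [g = h] then [u] is [w] or [v]; it is not its own neighbour [w], and [u = v] would lie in
       both [e] and [f]. *)
    apply: contraTneq ue => gh; rewrite (disjointFl disj) //.
    suff -> : u = v by [].
    have : u \in val h by rewrite -gh gE set21.
    by rewrite hE => /set2P[uE|//]; move: uw; rewrite uE adj_irr.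
  - split; last by exists v; rewrite // hE set22.
    by apply: contraNneq wf => <-; rewrite hE set21.
move=> path_p last_p; have := disjoint_path_gt1 disj path_p last_p.
case: p path_p last_p => [|g' [|h' [|]]] //= /and3P[eg gf _] hf _.
by case: njoin; apply/joinedP => //; exists g'; rewrite eg -hf.
Qed.

End GenericSignedGraphs.
(** * A computable copy of the Petersen graph *)

(* Vertex [i] stands for the [i]-th of these pairs of symbols. *)
Definition pairs : seq (nat * nat) :=
  [:: (0, 1); (2, 3); (2, 4); (3, 4); (0, 4); (1, 4); (0, 3); (1, 3); (0, 2); (1, 2)].
(* A spanning tree rooted at 0: the [k]-th edge joins [k.+1] to its parent. *)
Definition tree : seq (nat * nat) :=
  [:: (0, 1); (0, 2); (0, 3); (1, 4); (1, 5); (2, 6); (2, 7); (3, 8); (3, 9)].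
(** The tree edges come first, so the last six of the fifteen signs are those off the tree. *)
Definition cedges : seq (nat * nat) :=
  tree ++ [:: (4, 7); (4, 9); (5, 6); (5, 8); (6, 9); (7, 8)].

Definition meet2 (c d : nat * nat) : bool :=
  [|| c.1 == d.1, c.1 == d.2, c.2 == d.1 | c.2 == d.2].
Definition cadj i j : bool := ~~ meet2 (nth (0, 0) pairs i) (nth (0, 0) pairs j).
Definition same2 (c d : nat * nat) : bool := (c == d) || (c == (d.2, d.1)).

(* A signature is encoded by its list of signs along [cedges]. *)
Definition csgn (b : seq bool) i j : bool :=
  nth false b (find (same2 (i, j)) cedges).
(* The switching that makes the edges of the tree positive. *)
Definition potential (b : seq bool) : seq bool :=
  foldl (fun z bc => rcons z (bc.1 (+) nth false z bc.2.1)) [:: false] (zip b tree).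
Definition normalize (b : seq bool) : seq bool :=
  let z := potential b in
  [seq nth false z c.1 (+) csgn b c.1 c.2 (+) nth false z c.2 | c <- cedges].
Definition pullback (q : seq nat) (b : seq bool) : seq bool :=
  [seq csgn b (nth 0 q c.1) (nth 0 q c.2) | c <- cedges].

(** Each permutation of the five symbols acts on [pairs]; the action is stored as the list of the
    images of the ten indices. *)
Definition autos : seq (seq nat) :=
  [seq [seq find (same2 (nth 0 p c.1, nth 0 p c.2)) pairs | c <- pairs]
  | p <- permutations (iota 0 5)].
Definition is_auto (q : seq nat) : bool :=
  perm_eq q (iota 0 10) &&
  all (fun i => all (fun j => cadj (nth 0 q i) (nth 0 q j) == cadj i j)
    (iota 0 10)) (iota 0 10).

Definition code (L : seq (nat * nat)) : seq bool :=
  [seq has (same2 c) L | c <- cedges].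
Definition orbit (b : seq bool) : seq (seq bool) :=
  [seq normalize (pullback q b) | q <- autos].
(* The negative edges of +P, P_1, P_{2,2}, P_{2,3}, P_{3,2}, P_{3,3}. *)
Definition reps : seq (seq (nat * nat)) :=
  [:: [::]; [:: (0, 1)]; [:: (0, 1); (2, 6)]; [:: (0, 1); (6, 9)];
      [:: (0, 1); (4, 7); (8, 3)]; [:: (0, 1); (6, 9); (7, 8)]].
Definition rep k := nth [::] reps k.

Fixpoint cwalks (b : seq bool) n i j c : nat :=
  if n is n'.+1 then
    sumn [seq cwalks b n' k j (c (+) csgn b i k) | k <- iota 0 10 & cadj i k]
  else (i == j) && ~~ c.
Definition ccw b n := sumn [seq cwalks b n i i true | i <- iota 0 10].

(** * Identification of the vertices with the indices below ten *)

Lemma ltn10E i : (i < 10) = (i \in iota 0 10).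
Proof. by rewrite mem_iota. Qed.

Fact card_pair0 : #|[set (ord0 : 'I_5); ord_max]| == 2.
Proof. by rewrite cards2. Qed.

(** Total by means of a default vertex: for [i >= 10] the pair read is [(0, 0)], which gives a
    singleton. *)
Definition vtx i : petersen :=
  insubd (Sub [set ord0; ord_max] card_pair0 : petersen)
    [set inord (nth (0, 0) pairs i).1; inord (nth (0, 0) pairs i).2].

Lemma pairs_lt i : i < 10 ->
  [/\ (nth (0, 0) pairs i).1 < 5, (nth (0, 0) pairs i).2 < 5
    & (nth (0, 0) pairs i).1 != (nth (0, 0) pairs i).2].
Proof. by move=> i_lt; apply/and3P; move: i i_lt; exact: all_lt. Qed.

Lemma val_vtx i : i < 10 ->
  val (vtx i) = [set inord (nth (0, 0) pairs i).1; inord (nth (0, 0) pairs i).2].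
Proof.
move=> /pairs_lt[i1_lt i2_lt i12]; apply: insubdK.
by rewrite unfold_in cards2 inord_eq ?i12.
Qed.

Lemma padj_vtx i j : i < 10 -> j < 10 -> padj (vtx i) (vtx j) = cadj i j.
Proof.
move=> i_lt j_lt; have [[i1 i2 _] [j1 j2 _]] := (pairs_lt i_lt, pairs_lt j_lt).
rewrite /padj disjoints_subset !val_vtx // subUset !sub1set !inE !inord_eq //.
by rewrite /cadj /meet2 !negb_or -andbA.
Qed.

Lemma vtxP u : exists2 i, i < 10 & u = vtx i.
Proof.
have /cards2P[x [y [xy uE]]] := valP u.
pose i := find (same2 (x : nat, y : nat)) pairs.
(* Stated for natural numbers and as an implication, so that it becomes a check over all pairs below
   5. *)
have : (x != y :> nat) ==> (i < 10) && same2 (x : nat, y : nat) (nth (0, 0) pairs i).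
  rewrite /i; move: (nat_of_ord x) (nat_of_ord y) (ltn_ord x) (ltn_ord y).
  by apply: all2_lt; vm_compute.
rewrite val_eqE xy => /andP[i_lt /orP iE]; exists i => //.
apply: val_inj; rewrite val_vtx // uE.
move: iE; case: (nth _ _ i) => a b [] /eqP[<- <-] /=; rewrite !inord_val //.
by rewrite setUC.
Qed.

Lemma card_petersen : #|{: petersen}| = 10.
Proof.
transitivity #|[set A : {set 'I_5} | #|A| == 2]|; last by rewrite card_draws card_ord.
by rewrite card_sig; apply: eq_card => A; rewrite !inE.
Qed.

Definition vertices : seq petersen := [seq vtx i | i <- iota 0 10].

Lemma mem_vertices u : u \in vertices.
Proof. by have [i i_lt ->] := vtxP u; rewrite map_f -?ltn10E. Qed.

(** A list of length ten that covers a type with ten elements has no repetition. *)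
Lemma uniq_vertices : uniq vertices.
Proof.
apply: (leq_size_uniq (enum_uniq {: petersen})) => [u _|]; first exact: mem_vertices.
by rewrite -cardE card_petersen size_map.
Qed.

Definition vidx (u : petersen) : nat := index u vertices.

Lemma vidx_lt u : vidx u < 10.
Proof. by have := mem_vertices u; rewrite -index_mem size_map. Qed.

Lemma vidxK : cancel vidx vtx.
Proof.
move=> u; have u_lt := vidx_lt u.
by rewrite -{2}(nth_index u (mem_vertices u)) (nth_map 0) ?size_iota // nth_iota.
Qed.

Lemma vtxK i : i < 10 -> vidx (vtx i) = i.
Proof.
move=> i_lt; rewrite /vidx.
have -> : vtx i = nth (vtx 0) vertices i.
  by rewrite (nth_map 0) ?size_iota // nth_iota.
by rewrite index_uniq ?size_map // uniq_vertices.
Qed.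

Lemma vtx_eq i j : i < 10 -> j < 10 -> (vtx i == vtx j) = (i == j).
Proof.
by move=> i_lt j_lt; apply/eqP/eqP => [/(congr1 vidx)|->//]; rewrite !vtxK.
Qed.

Lemma perm_vertices : perm_eq (index_enum petersen) vertices.
Proof.
apply: uniq_perm; rewrite ?index_enum_uniq ?uniq_vertices // => u.
by rewrite mem_index_enum mem_vertices.
Qed.

(** * Encoded signatures and their normal forms *)

Lemma cadj_cedges i j : i < 10 -> j < 10 -> cadj i j -> has (same2 (i, j)) cedges.
Proof.
move=> i_lt j_lt; apply/implyP; move: i j i_lt j_lt.
by apply: all2_lt; vm_compute.
Qed.

Lemma csgnC b i j : csgn b i j = csgn b j i.
Proof.
congr nth; apply: eq_find => -[k l]; rewrite /same2 !xpair_eqE /=.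
by rewrite orbC andbC [X in _ || X]andbC.
Qed.

(** Symmetry of [F] absorbs the orientation in which [cedges] lists the edge. *)
Lemma csgn_map (F : nat -> nat -> bool) i j : (forall k l, F k l = F l k) ->
  i < 10 -> j < 10 -> cadj i j -> csgn [seq F c.1 c.2 | c <- cedges] i j = F i j.
Proof.
move=> F_sym i_lt j_lt ij; have c_in := cadj_cedges i_lt j_lt ij.
rewrite /csgn (nth_map (0, 0)) -?has_find //.
have := nth_find (0, 0) c_in; case: (nth _ _ _) => a b.
by case/orP=> /eqP[-> ->] /=.
Qed.

Definition bits (s : psignature) : seq bool :=
  [seq sgn s (vtx c.1) (vtx c.2) | c <- cedges].

Lemma csgn_bits s i j : i < 10 -> j < 10 -> cadj i j ->
  csgn (bits s) i j = sgn s (vtx i) (vtx j).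
Proof.
by apply: (csgn_map (F := fun i j => sgn s (vtx i) (vtx j))) => k l; apply: sgnC.
Qed.

Lemma csgn_normalize b i j (z := nth false (potential b)) :
  i < 10 -> j < 10 -> cadj i j ->
  csgn (normalize b) i j = z i (+) csgn b i j (+) z j.
Proof.
apply: (csgn_map (F := fun i j => z i (+) csgn b i j (+) z j)) => k l.
by rewrite csgnC; case: (z k); case: (z l); case: csgn.
Qed.

Lemma csgn_pullback q b i j : i < 10 -> j < 10 -> cadj i j ->
  csgn (pullback q b) i j = csgn b (nth 0 q i) (nth 0 q j).
Proof.
apply: (csgn_map (F := fun i j => csgn b (nth 0 q i) (nth 0 q j))) => k l.
exact: csgnC.
Qed.

Lemma autosP q : q \in autos -> is_auto q.
Proof. by move: q; apply/allP; vm_compute. Qed.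

(** The link between computation and theory: equal normal forms mean that [s] and the pullback of
    [t] along [q] differ by the product of their two potentials, and [q] is an automorphism. *)
Lemma normalize_pullback_sw q (s t : psignature) : q \in autos ->
  normalize (bits s) = normalize (pullback q (bits t)) -> s ~=sw t.
Proof.
move=> /autosP/andP[q_perm q_adj] nst; apply/(swP padj_irr).
have q_size : size q = 10 by rewrite (perm_size q_perm).
have q_lt i : i < 10 -> nth 0 q i < 10.
  by move=> i_lt; rewrite ltn10E -(perm_mem q_perm) mem_nth ?q_size.
pose f u := vtx (nth 0 q (vidx u)).
have f_inj : injective f.
  move=> u v /eqP; rewrite vtx_eq ?q_lt ?vidx_lt //.
  rewrite nth_uniq ?q_size ?vidx_lt ?(perm_uniq q_perm) ?iota_uniq // => /eqP.
  exact: (can_inj vidxK).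
have fE i : i < 10 -> perm f_inj (vtx i) = vtx (nth 0 q i).
  by move=> i_lt; rewrite permE /f vtxK.
pose z u := nth false (potential (bits s)) (vidx u) (+)
            nth false (potential (pullback q (bits t))) (vidx u).
have q_cadj i j : i < 10 -> j < 10 -> cadj (nth 0 q i) (nth 0 q j) = cadj i j.
  by move=> i_lt j_lt; apply/eqP; move: i j i_lt j_lt; apply: all2_lt.
exists (perm f_inj), z; split=> u v; have [i i_lt ->] := vtxP u;
  have [j j_lt ->] := vtxP v; rewrite !fE // !padj_vtx ?q_lt ?q_cadj // => ij.
have := congr1 (fun b => csgn b i j) nst.
rewrite !csgn_normalize // csgn_pullback // !csgn_bits ?q_lt ?q_cadj //.
by rewrite /z !vtxK //; apply: addb_exchange.
Qed.

(** * Edges as pairs of indices *)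

Definition cedge (c : nat * nat) : {set petersen} := [set vtx c.1; vtx c.2].

Definition in_range (c : nat * nat) : bool :=
  [&& c.1 < 10, c.2 < 10 & cadj c.1 c.2].

Lemma cedges_in_range c : c \in cedges -> in_range c.
Proof. by move: c; apply/allP; vm_compute. Qed.

Lemma cedge_edge c : in_range c -> exists e : edge padj, val e = cedge c.
Proof. by case/and3P=> c1 c2 cc; apply: adj_edge; rewrite padj_vtx. Qed.

Lemma edge_cedge (e : edge padj) : exists2 c, c \in cedges & val e = cedge c.
Proof.
have [u [v [uv ->]]] := edgeP e.
have [[i i_lt uE] [j j_lt vE]] := (vtxP u, vtxP v); rewrite {}uE {}vE in uv *.
rewrite padj_vtx // in uv.
have /hasP[[k l] kl_in ij] := cadj_cedges i_lt j_lt uv.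
exists (k, l) => //; case/orP: ij => /eqP[-> ->] //.
exact: setUC.
Qed.

Lemma cadj_neq i j : cadj i j -> i != j.
Proof. by apply: contraTneq => ->; rewrite /cadj /meet2 eqxx. Qed.

Lemma cedge_eq c d : in_range c -> in_range d -> (cedge c == cedge d) = same2 c d.
Proof.
case: c d => [i j] [k l] /and3P[i_lt j_lt ij] /and3P[k_lt l_lt _].
by rewrite set2_eq ?vtx_eq ?(cadj_neq ij).
Qed.

Lemma bits_code L (s : psignature) : all in_range L ->
  (forall e, s e = (val e \in [seq cedge c | c <- L])) -> bits s = code L.
Proof.
move=> /allP L_in sE; apply/eq_in_map => c /cedges_in_range c_in.
have [e eE] := cedge_edge c_in; rewrite (sgnE _ eE) sE eE.
apply/mapP/hasP => -[d dL cd]; exists d => //;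
  have d_in := L_in d dL.
  by rewrite -cedge_eq // cd.
by apply/eqP; rewrite cedge_eq.
Qed.

Lemma bits_code_neg L (es : seq (edge padj)) (s : psignature) : all in_range L ->
  neg_edges s = [set e in es] -> map val es = map cedge L -> bits s = code L.
Proof.
move=> L_in sE esL; apply: bits_code => // e.
rewrite -esL mem_map; last exact: val_inj.
by have := in_set (mem es) e; rewrite -sE inE.
Qed.

(** * The six representatives and their invariants *)

Definition srep k : psignature := [ffun e => val e \in [seq cedge c | c <- rep k]].

Lemma rep_in_range k : all in_range (rep k).
Proof.
have [k_lt|k_ge] := ltnP k 6; last by rewrite /rep nth_default.
by move: k k_lt; apply: all_lt; vm_compute.
Qed.

Lemma bits_srep k : bits (srep k) = code (rep k).
Proof. by apply: bits_code => [|e]; [exact: rep_in_range | rewrite ffunE]. Qed.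

Lemma orbit_sw s k : normalize (bits s) \in orbit (code (rep k)) -> s ~=sw srep k.
Proof.
rewrite -bits_srep => /mapP[q q_in].
exact: normalize_pullback_sw.
Qed.

Lemma walks_cwalks s n i j c : i < 10 -> j < 10 ->
  walks s n (vtx i) (vtx j) c = cwalks (bits s) n i j c.
Proof.
move=> + j_lt; elim: n i c => [|n IHn] i c i_lt; first by rewrite /= vtx_eq.
have -> : cwalks (bits s) n.+1 i j c =
    sumn [seq cwalks (bits s) n k j (c (+) csgn (bits s) i k) |
           k <- iota 0 10 & cadj i k] by [].
rewrite sumnE big_map big_filter /= (perm_big _ perm_vertices) big_map.
rewrite [in LHS]big_seq_cond [in RHS]big_seq_cond.
apply: eq_big => k; rewrite -ltn10E.
  by case k_lt: (k < 10) => //=; rewrite padj_vtx.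
by case/andP=> k_lt; rewrite padj_vtx // => ik; rewrite IHn // csgn_bits.
Qed.

Lemma neg_closed_walksE s n : neg_closed_walks s n = ccw (bits s) n.
Proof.
rewrite /neg_closed_walks (perm_big _ perm_vertices) big_map /ccw sumnE big_map.
rewrite [LHS]big_seq [RHS]big_seq; apply: eq_bigr => i; rewrite -ltn10E => i_lt.
exact: walks_cwalks.
Qed.

(** Since the girth is 5, these are 10 times the number of negative pentagons and 12 times the
    number of negative hexagons: any other closed walk of length 6 uses every edge an even number of
    times and is positive. *)
Definition neg_counts (s : psignature) : nat * nat :=
  (neg_closed_walks s 5, neg_closed_walks s 6).

Lemma neg_counts_srep_inj : {in gtn 6 &, injective (neg_counts \o srep)}.
Proof.
apply/mkseq_uniqP.
rewrite (eq_mkseq (g := fun k => (ccw (code (rep k)) 5, ccw (code (rep k)) 6))).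
  by vm_compute.
by move=> k; rewrite /= /neg_counts !neg_closed_walksE bits_srep.
Qed.

Lemma srep_inj k l : k < 6 -> l < 6 -> srep k ~=sw srep l -> k = l.
Proof.
move=> k_lt l_lt kl; apply: (neg_counts_srep_inj k_lt l_lt).
by rewrite /= /neg_counts !(neg_closed_walks_sw padj_irr _ kl).
Qed.

(** * The 64 normal forms *)

Fixpoint all_bits n (P : pred (seq bool)) : bool :=
  if n is n'.+1 then all_bits n' (P \o cons true) && all_bits n' (P \o cons false)
  else P [::].

Lemma all_bitsP n (P : pred (seq bool)) : all_bits n P -> forall b, size b = n -> P b.
Proof.
elim: n P => [|n IHn] P /=; first by move=> P0 [].
by move=> /andP[/IHn Pt /IHn Pf] [//|[] b] [] b_size; [apply: Pt | apply: Pf].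
Qed.

Lemma take_normalize b : size b = 15 -> take 9 (normalize b) = nseq 9 false.
Proof.
case: b => [|b0 [|b1 [|b2 [|b3 [|b4 [|b5 [|b6 [|b7 b]]]]]]]] b_size;
  try discriminate b_size.
case: b b_size => [|b8 [|b9 [|b10 [|b11 [|b12 [|b13 [|b14 [|b15 b]]]]]]]] b_size;
  try discriminate b_size.
(* The entries at the tree edges depend only on the tree signs [b0] to [b8], so splitting on these
   is enough. *)
vm_compute; clear b_size.
case: b0; case: b1; case: b2; case: b3; case: b4; case: b5; case: b6;
  by case: b7; case: b8.
Qed.

(* [O] is a parameter so that [vm_compute] evaluates the orbits only once. *)
Definition cotree_in_orbits (O : seq (seq bool)) : bool :=
  all_bits 6 (fun b => nseq 9 false ++ b \in O).

Lemma normalize_orbit b : size b = 15 ->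
  exists2 k, k < 6 & normalize b \in orbit (code (rep k)).
Proof.
move=> /take_normalize b9; rewrite -[normalize b](cat_take_drop 9) b9.
have : size (drop 9 (normalize b)) = 6 by rewrite size_drop size_map.
(* The first nine signs are known to be positive; generalizing the other six leaves 64 lists to look
   up in the union of the six orbits. *)
move: (drop 9 _); suff /all_bitsP tail_orbit :
    cotree_in_orbits (flatten [seq orbit (code (rep k)) | k <- iota 0 6]).
  move=> c /tail_orbit/flatten_mapP[k]; rewrite mem_iota => k_lt c_in.
  by exists k.
by vm_compute.
Qed.

Lemma sw_srep s : exists2 k, k < 6 & s ~=sw srep k.
Proof.
have [|k k_lt sk] := @normalize_orbit (bits s); first by rewrite size_map.
by exists k => //; apply: orbit_sw.
Qed.

(** * Distances between edges of the Petersen graph *)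

Definition cjoined (c d : nat * nat) : bool :=
  [|| cadj c.1 d.1, cadj c.1 d.2, cadj c.2 d.1 | cadj c.2 d.2].

Lemma disjoint_cedge c d : in_range c -> in_range d ->
  [disjoint cedge c & cedge d] = ~~ meet2 c d.
Proof.
move=> /and3P[c1 c2 _] /and3P[d1 d2 _].
rewrite disjoints_subset subUset !sub1set !inE !vtx_eq // /meet2 !negb_or.
by rewrite -andbA.
Qed.

Lemma joined_cedge (e f : edge padj) c d : in_range c -> in_range d ->
  val e = cedge c -> val f = cedge d -> joined e f <-> cjoined c d.
Proof.
move=> /and3P[c1 c2 _] /and3P[d1 d2 _] eE fE.
rewrite /joined eE fE /cjoined -!padj_vtx //; split.
  by case=> u [v [/set2P[]-> /set2P[]-> ->]]; rewrite ?orbT.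
by case/or4P=> uv; do 2!eexists; split; try exact: uv; rewrite ?set21 ?set22.
Qed.

(** For distinct edges, [near] and [far] are computable tests for distance 2 and distance 3. *)
Definition near c d := ~~ meet2 c d && cjoined c d.
Definition far c d := ~~ meet2 c d && ~~ cjoined c d.

Lemma near_edge_dist (e f : edge padj) c d : in_range c -> in_range d ->
  val e = cedge c -> val f = cedge d -> e != f -> edge_dist e f 2 <-> near c d.
Proof.
move=> c_in d_in eE fE ef; have eP := edge_dist2P padj_sym ef; apply: (iff_trans eP).
have := joined_cedge c_in d_in eE fE; rewrite eE fE disjoint_cedge // => -[ef_cd cd_ef].
by split=> [[cd /ef_cd cd'] | /andP[cd /cd_ef]//]; apply/andP.
Qed.

Lemma edge_dist_far (e f : edge padj) c d : in_range c -> in_range d ->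
  val e = cedge c -> val f = cedge d -> e != f -> edge_dist e f 3 -> far c d.
Proof.
move=> c_in d_in eE fE ef /(edge_dist3_far padj_sym ef).
rewrite eE fE disjoint_cedge // => -[cd njoin]; apply/andP; split=> //.
by apply/negP=> /(joined_cedge c_in d_in eE fE).
Qed.

(** The graph has diameter 2. This supplies the middle vertex of a line graph path of length 3
    between two edges that are disjoint and not joined. *)
Lemma common_neighbour i j : i < 10 -> j < 10 -> i != j -> ~~ cadj i j ->
  has (fun k => cadj i k && cadj k j) (iota 0 10).
Proof.
move=> i_lt j_lt ij; apply/implyP; move: ij; apply/implyP; move: i j i_lt j_lt.
by apply: all2_lt; vm_compute.
Qed.

Lemma far_edge_dist (e f : edge padj) c d : in_range c -> in_range d ->
  val e = cedge c -> val f = cedge d -> far c d -> edge_dist e f 3.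
Proof.
move=> c_in d_in eE fE /andP[cd_disj cd_join].
have disj : [disjoint val e & val f] by rewrite eE fE disjoint_cedge.
have [/and3P[c1 _ _] /and3P[d1 _ _]] := (c_in, d_in).
have cd1 : c.1 != d.1 by case/norP: cd_disj.
have ncd1 : ~~ cadj c.1 d.1 by case/norP: cd_join.
have /hasP[k] := common_neighbour c1 d1 cd1 ncd1.
rewrite -ltn10E => k_lt /andP[ck kd].
apply: (far_edge_dist3 padj_sym padj_irr disj (u := vtx c.1) (v := vtx d.1) (w := vtx k)).
- by move=> /(joined_cedge c_in d_in eE fE); apply/negP.
- by rewrite eE set21.
- by rewrite fE set21.
- by rewrite padj_vtx.
- by rewrite padj_vtx.
Qed.

(** * The named signatures *)

Lemma neg_edges_rep L (es : seq (edge padj)) (s : psignature) :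
  (forall e, s e = (val e \in [seq cedge c | c <- L])) ->
  map val es = map cedge L -> neg_edges s = [set e in es].
Proof.
move=> sE esL; apply/setP=> e; rewrite !inE sE -esL mem_map //.
exact: val_inj.
Qed.

Lemma srepE k e : srep k e = (val e \in [seq cedge c | c <- rep k]).
Proof. by rewrite ffunE. Qed.

Lemma srep_P1 : is_P1 (srep 1).
Proof.
have [e eE] := cedge_edge (isT : in_range (0, 1)).
rewrite /is_P1 (neg_edges_rep (es := [:: e]) (srepE 1)) /= ?eE //.
by rewrite set_seq1 cards1.
Qed.

Lemma neg_at_dist2 (s : psignature) e f d : e != f -> neg_edges s = [set e; f] ->
  edge_dist e f d -> edge_dist f e d -> neg_at_dist s 2 d.
Proof.
move=> ef sE efd fed; split; first by rewrite sE cards2 ef.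
by move=> g h; rewrite sE => /set2P[]-> /set2P[]->; rewrite ?eqxx.
Qed.

Lemma srep_P22 : is_P22 (srep 2).
Proof.
have [c_in d_in] : in_range (0, 1) /\ in_range (2, 6) by [].
have [[e eE] [f fE]] := (cedge_edge c_in, cedge_edge d_in).
have ef : e != f by rewrite -val_eqE /= eE fE cedge_eq.
have fe : f != e by rewrite eq_sym.
apply: (neg_at_dist2 ef).
- rewrite (neg_edges_rep (es := [:: e; f]) (srepE 2)) /= ?eE ?fE //.
  by apply/setP=> g; rewrite !inE.
- exact/(near_edge_dist c_in d_in).
- exact/(near_edge_dist d_in c_in).
Qed.

Lemma srep_P23 : is_P23 (srep 3).
Proof.
have [c_in d_in] : in_range (0, 1) /\ in_range (6, 9) by [].
have [[e eE] [f fE]] := (cedge_edge c_in, cedge_edge d_in).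
have ef : e != f by rewrite -val_eqE /= eE fE cedge_eq.
apply: (neg_at_dist2 ef).
- rewrite (neg_edges_rep (es := [:: e; f]) (srepE 3)) /= ?eE ?fE //.
  by apply/setP=> g; rewrite !inE.
- exact: (far_edge_dist c_in d_in).
- exact: (far_edge_dist d_in c_in).
Qed.

Lemma srep_P33 : is_P33 (srep 5).
Proof.
have far_rep c d : c \in rep 5 -> d \in rep 5 -> c != d -> far c d.
  move=> c_in d_in; apply/implyP; move: c d c_in d_in.
  have /allrelP : allrel (fun c d => (c != d) ==> far c d) (rep 5) (rep 5) by [].
  by [].
have rep_in c : c \in rep 5 -> in_range c by apply/allP; exact: rep_in_range.
split.
  have [e eE] := cedge_edge (isT : in_range (0, 1)).
  have [f fE] := cedge_edge (isT : in_range (6, 9)).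
  have [g gE] := cedge_edge (isT : in_range (7, 8)).
  rewrite (neg_edges_rep (es := [:: e; f; g]) (srepE 5)) /= ?eE ?fE ?gE //.
  rewrite cardsE (card_uniqP _) // -(map_inj_uniq val_inj) /= eE fE gE.
  by rewrite !inE !cedge_eq.
move=> e f; rewrite !inE !srepE => /mapP[c c_in eE] /mapP[d d_in fE] ef.
apply: (far_edge_dist (rep_in _ c_in) (rep_in _ d_in) eE fE (far_rep _ _ c_in d_in _)).
by apply: contraNneq ef => cd; rewrite -val_eqE /= eE fE cd.
Qed.

Lemma srep_P32 : is_P32 (srep 4).
Proof.
(* A hexagon whose first, third and fifth edges are the three pairs of [rep 4]. *)
exists (vtx 0), (vtx 1), (vtx 4), (vtx 7), (vtx 8), (vtx 3); split.
  by rewrite /ucycle /= !inE !vtx_eq // !padj_vtx.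
apply/setP=> X; rewrite !inE -orbA; apply/imsetP/idP => [[e] | ].
  by rewrite inE srepE => e_in ->; move: e_in; rewrite !inE.
have XE : (X \in [seq cedge c | c <- rep 4]) =
  [|| X == cedge (0, 1), X == cedge (4, 7) | X == cedge (8, 3)] by rewrite !inE.
rewrite -XE => X_in; have /mapP[c c_in Xc] := X_in.
have [|e eE] := @cedge_edge c; first by have /allP := rep_in_range 4; apply.
by exists e; rewrite ?inE ?srepE eE -?Xc.
Qed.

(** * From the named signatures to the representatives *)

Lemma P1_srep s : is_P1 s -> s ~=sw srep 1.
Proof.
move=> /eqP/cards1P[e sE]; have [c c_in eE] := edge_cedge e.
apply: orbit_sw; rewrite (@bits_code_neg [:: c] [:: e]) /= ?eE //.
(* A check over the fifteen edges takes the place of edge transitivity. *)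
- by move: c c_in {eE}; apply/allP; vm_compute.
- by rewrite andbT cedges_in_range.
- by rewrite set_seq1.
Qed.

Definition pairs_in_orbit (r : rel (nat * nat)) (O : seq (seq bool)) : bool :=
  all (fun c => all (fun d => normalize (code [:: c; d]) \in O)
    [seq d <- cedges | r c d]) cedges.

Lemma pairs_in_orbit_sw (r : rel (nat * nat)) k (s : psignature) e f :
  pairs_in_orbit r (orbit (code (rep k))) -> neg_edges s = [set e; f] ->
  (forall c d, in_range c -> in_range d -> val e = cedge c -> val f = cedge d -> r c d) ->
  s ~=sw srep k.
Proof.
move=> /allP rO sE r_cd.
have [[c c_in eE] [d d_in fE]] := (edge_cedge e, edge_cedge f).
have [c_rg d_rg] := (cedges_in_range c_in, cedges_in_range d_in).
apply: orbit_sw; rewrite (@bits_code_neg [:: c; d] [:: e; f]) /= ?eE ?fE ?c_rg ?d_rg //.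
  by have /allP := rO c c_in; apply; rewrite mem_filter d_in r_cd.
by rewrite sE; apply/setP=> g; rewrite !inE.
Qed.

Lemma neg_at_dist2P (s : psignature) d : neg_at_dist s 2 d ->
  exists e f, [/\ e != f, neg_edges s = [set e; f] & edge_dist e f d].
Proof.
case=> /eqP/cards2P[e [f [ef sE]]] efd; exists e, f; split=> //.
by apply: efd; rewrite // sE ?set21 ?set22.
Qed.

Lemma P22_srep s : is_P22 s -> s ~=sw srep 2.
Proof.
move=> /neg_at_dist2P[e [f [ef sE efd]]].
apply: (pairs_in_orbit_sw (r := near) _ sE); first by vm_compute.
by move=> c d c_in d_in eE fE; apply/(near_edge_dist c_in d_in eE fE ef).
Qed.

Lemma P23_srep s : is_P23 s -> s ~=sw srep 3.
Proof.
move=> /neg_at_dist2P[e [f [ef sE efd]]].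
apply: (pairs_in_orbit_sw (r := far) _ sE); first by vm_compute.
by move=> c d c_in d_in eE fE; apply: (edge_dist_far c_in d_in eE fE ef).
Qed.

(** The three [far] conditions run cyclically through [c], [d], [b], like the inequalities that
    [card_gt2P] provides. *)
Definition triples_in_orbit (O : seq (seq bool)) : bool :=
  all (fun c => all (fun d => all (fun b => normalize (code [:: c; d; b]) \in O)
    [seq b <- cedges | far d b && far b c]) [seq d <- cedges | far c d]) cedges.

Lemma triples_orbit : triples_in_orbit (orbit (code (rep 5))).
Proof. by vm_compute. Qed.

Lemma P33_srep s : is_P33 s -> s ~=sw srep 5.
Proof.
case=> s3 s_far.
have /card_gt2P[e [f [g [[es fs gs] [ef fg ge]]]]] : 2 < #|neg_edges s| by rewrite s3.
have efg_uniq : uniq [:: e; f; g] by rewrite /= !inE (eq_sym e g) negb_or ef ge fg.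
have sE : neg_edges s = [set x in [:: e; f; g]].
  apply: set_seq_card => //; apply/allP.
  by rewrite /= es fs gs.
have [c c_in eE] := edge_cedge e; have [d d_in fE] := edge_cedge f.
have [b b_in gE] := edge_cedge g.
have [c_rg d_rg] := (cedges_in_range c_in, cedges_in_range d_in).
have b_rg := cedges_in_range b_in.
apply: orbit_sw.
rewrite (@bits_code_neg [:: c; d; b] [:: e; f; g]) /= ?eE ?fE ?gE ?c_rg ?d_rg ?b_rg //.
have cd : far c d by apply: (edge_dist_far c_rg d_rg eE fE ef); apply: s_far.
have db : far d b by apply: (edge_dist_far d_rg b_rg fE gE fg); apply: s_far.
have bc : far b c by apply: (edge_dist_far b_rg c_rg gE eE ge); apply: s_far.
have /allP/(_ c c_in)/allP/(_ d)/[!mem_filter] := triples_orbit.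
by rewrite cd d_in => /(_ isT)/allP/(_ b); rewrite mem_filter db bc b_in; apply.
Qed.

Definition neighbours i : seq nat := [seq j <- iota 0 10 | cadj i j].

Lemma mem_neighbours i j : (j \in neighbours i) = (j < 10) && cadj i j.
Proof. by rewrite mem_filter -ltn10E andbC. Qed.

(** The search follows neighbours, with at most three choices at each step after the first; closure
    and distinctness are tested at the last vertex. *)
Definition hexagons_in_orbit (O : seq (seq bool)) : bool :=
  all (fun a => all (fun b => all (fun c => all (fun d => all (fun e => all (fun f =>
    normalize (code [:: (a, b); (c, d); (e, f)]) \in O)
    [seq f <- neighbours e | cadj f a && uniq [:: a; b; c; d; e; f]])
    (neighbours d)) (neighbours c)) (neighbours b)) (neighbours a)) (iota 0 10).

Lemma hexagons_orbit : hexagons_in_orbit (orbit (code (rep 4))).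
Proof. by vm_compute. Qed.

Lemma P32_srep s : is_P32 s -> s ~=sw srep 4.
Proof.
case=> [a' [b' [c' [d' [e' [f' [/andP[hex hex_uniq] sE]]]]]]].
move: hex hex_uniq sE.
have [[a a_lt ->] [b b_lt ->]] := (vtxP a', vtxP b').
have [[c c_lt ->] [d d_lt ->]] := (vtxP c', vtxP d').
have [[e e_lt ->] [f f_lt ->]] := (vtxP e', vtxP f').
rewrite /= !padj_vtx // andbT => /and5P[ab bc cd de /andP[ef fa]] hex_uniq sE.
have {}hex_uniq : uniq [:: a; b; c; d; e; f].
  by move: hex_uniq; rewrite /= !inE !vtx_eq.
apply: orbit_sw; rewrite (@bits_code [:: (a, b); (c, d); (e, f)]).
- move: (orbit _) hexagons_orbit => O; rewrite /hexagons_in_orbit.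
  have nbr i j (j_lt : j < 10) (ij : cadj i j) : j \in neighbours i.
    by rewrite mem_neighbours j_lt.
  move=> /all_lt/(_ a a_lt)/allP/(_ b (nbr _ _ b_lt ab)).
  move=> /allP/(_ c (nbr _ _ c_lt bc))/allP/(_ d (nbr _ _ d_lt cd)).
  move=> /allP/(_ e (nbr _ _ e_lt de))/allP; apply.
  by rewrite mem_filter fa hex_uniq nbr.
- by rewrite /in_range /= a_lt b_lt c_lt d_lt e_lt f_lt ab cd ef.
move=> g; have /setP/(_ (val g)) := sE.
by rewrite mem_imset ?inE -?orbA //; apply: val_inj.
Qed.

(** * Negation and the classification *)

(** The effect of negation on classes, numbered as in [reps]: 0 and 5 are swapped, 1 and 3 are
    swapped, 2 and 4 are fixed. *)
Definition opposite k : nat := nth 0 [:: 5; 3; 2; 1; 4; 0] k.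

Lemma bits_negate s : bits (negate s) = map negb (bits s).
Proof.
rewrite -map_comp; apply/eq_in_map => c /cedges_in_range/and3P[c1 c2 cc] /=.
by rewrite sgn_negate ?padj_vtx.
Qed.

Lemma srep_negate k : k < 6 -> negate (srep k) ~=sw srep (opposite k).
Proof.
move=> k_lt; apply: orbit_sw; rewrite bits_negate bits_srep.
by move: k k_lt; apply: all_lt; vm_compute.
Qed.

Lemma plusP_srep : plusP = srep 0.
Proof. by apply/ffunP=> e; rewrite !ffunE. Qed.

Theorem theorem5p1 :
  [/\ exists s, is_P1 s, exists s, is_P22 s, exists s, is_P23 s,
      exists s, is_P32 s & exists s, is_P33 s] /\
  forall P1 P22 P23 P32 P33 : psignature,
    is_P1 P1 -> is_P22 P22 -> is_P23 P23 -> is_P32 P32 -> is_P33 P33 ->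
  [/\ forall s : psignature,
        count (fun t => s ~=sw t) [:: plusP; P1; P22; P23; P32; P33] = 1,
      #|equivalence_partition (fun s t : psignature => s ~=sw t) [set: psignature]| = 6
    & (plusP ~=sw negate P33) /\ (P1 ~=sw negate P23) /\
      (P22 ~=sw negate P22) /\ (P23 ~=sw negate P1) /\
      (P32 ~=sw negate P32) /\ (P33 ~=sw negate plusP)].
Proof.
split.
  split; [exists (srep 1) | exists (srep 2) | exists (srep 3)
    | exists (srep 4) | exists (srep 5)].
  - exact: srep_P1.
  - exact: srep_P22.
  - exact: srep_P23.
  - exact: srep_P32.
  - exact: srep_P33.
move=> P1 P22 P23 P32 P33 /P1_srep P1r /P22_srep P22r /P23_srep P23r
  /P32_srep P32r /P33_srep P33r.
have P0r : plusP ~=sw srep 0 by rewrite plusP_srep; apply: sw_refl padj_irr _.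
(* All six negation claims are instances of this, with [k] the index of the signature that is
   negated. *)
have neg k s t : k < 6 -> s ~=sw srep k -> t ~=sw srep (opposite k) -> t ~=sw negate s.
  move=> k_lt /(sw_negate padj_irr) sk tk.
  apply: (sw_trans padj_irr tk); apply: (sw_sym padj_irr).
  exact: (sw_trans padj_irr sk (srep_negate k_lt)).
split; last first.
- split; first exact: (neg 5 _ _ isT P33r P0r).
  split; first exact: (neg 3 _ _ isT P23r P1r).
  split; first exact: (neg 2 _ _ isT P22r P22r).
  split; first exact: (neg 1 _ _ isT P1r P23r).
  by split; [exact: (neg 4 _ _ isT P32r P32r) | exact: (neg 0 _ _ isT P0r P33r)].
- apply: (@card_equivalence_partition _ _ 6 srep).
  + exact: sw_refl padj_irr.
  + exact: sw_sym padj_irr.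
  + exact: sw_trans padj_irr.
  + exact: sw_srep.
  + exact: srep_inj.
move=> s; have [k k_lt sk] := sw_srep s.
(* With [k] the class of [s], the count becomes the number of [l] below 6 equal to [k], which is
   1. *)
have swE l t : l < 6 -> t ~=sw srep l -> (s ~=sw t) = (k == l).
  move=> l_lt tl; apply/idP/eqP => [st | kl].
    have kt := sw_trans padj_irr (sw_sym padj_irr sk) st.
    exact: (srep_inj k_lt l_lt (sw_trans padj_irr kt tl)).
  apply: (sw_trans padj_irr sk); rewrite kl; exact: (sw_sym padj_irr tl).
rewrite /= (swE 0 _ _ P0r) // (swE 1 _ _ P1r) // (swE 2 _ _ P22r) //.
rewrite (swE 3 _ _ P23r) // (swE 4 _ _ P32r) // (swE 5 _ _ P33r) //.
clear sk swE; by do 6 case: k k_lt => [//|k] k_lt.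
Qed.
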